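(* Let $G = (V, E)$ be a graph. If $\beta \geq \frac{1}{2}$, then $$\alpha(G) = \alpha(G,\beta).$$
   Context: Graphs are finite, simple and undirected, with vertex set $V = \{v_1,\ldots,v_n\}$ and edge set $E$. A stable set in $G$ is a subset of pairwise non-adjacent vertices, and $\alpha(G)$ denotes the maximum cardinality of a stable set in $G$ (the stability number). Let $A$ be the adjacency matrix of $G$ and $e \in \mathbb{R}^n$ the all-ones vector. For a real penalty parameter $\beta > 0$, define $$\alpha(G,\beta) = -\min\{-e^T x + \beta x^T A x \mid x \in \{0,1\}^n\}.$$ *)

(* Defs.v *)
From HB Require Import structures.
From mathcomp Require Import all_boot all_order all_algebra.
From mathcomp Require Import reals.

Set Implicit Arguments.
Unset Strict Implicit.
Unset Printing Implicit Defensive.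

Import Order.TTheory GRing.Theory Num.Theory.
Local Open Scope ring_scope.

Record sgraph (n : nat) := SGraph {
  adj :> rel 'I_n;
  adj_sym : symmetric adj;
  adj_irr : irreflexive adj }.

Definition stable_set (n : nat) (G : sgraph n) (S : {set 'I_n}) : bool :=
  [forall u in S, forall v in S, (u != v) ==> ~~ G u v].

Definition stability_number (n : nat) (G : sgraph n) : nat :=
  (\max_(S : {set 'I_n} | stable_set G S) #|S|)%N.

Definition adjmx (R : realType) (n : nat) (G : sgraph n) : 'M[R]_n :=
  \matrix_(i, j) (G i j)%:R.

Definition ones (R : realType) (n : nat) : 'cV[R]_n := const_mx 1.

(* The products are 1 x 1 matrices; the scalar is their (0, 0) entry. *)
Definition pen_obj (R : realType) (n : nat) (G : sgraph n) (beta : R)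
    (x : 'cV[R]_n) : R :=
  (- ((ones R n)^T *m x) + beta *: (x^T *m adjmx R G *m x)) 0 0.

(* {0,1}^n is enumerated by boolean column vectors, embedded in R^n;
   see binvecP. *)
Definition binvec (R : realType) (n : nat) (b : 'cV[bool]_n) : 'cV[R]_n :=
  \col_i (b i 0)%:R.

(* The starting point [const_mx false] only witnesses that the cube is
   nonempty; see pen_min_attained and pen_min_le. *)
Definition pen_min (R : realType) (n : nat) (G : sgraph n) (beta : R) : R :=
  pen_obj G beta
    (binvec R [arg min_(b < const_mx false : 'cV[bool]_n)
                 pen_obj G beta (binvec R b)]%O).

Definition pen_stability_number (R : realType) (n : nat) (G : sgraph n)
    (beta : R) : R :=
  - pen_min G beta.

Lemma binvecP (R : realType) (n : nat) (x : 'cV[R]_n) :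
  (forall i, x i 0 = 0 \/ x i 0 = 1) <-> exists b, x = binvec R b.
Proof.
split=> [x01 | [b ->] i]; last by rewrite mxE; case: (b i 0); [right | left].
exists (\col_i (x i 0 == 1)); apply/colP => i; rewrite !mxE.
by case: (x01 i) => ->; rewrite ?eqxx // eq_sym oner_eq0.
Qed.

Lemma pen_min_attained (R : realType) (n : nat) (G : sgraph n) (beta : R) :
  exists2 x : 'cV[R]_n, (forall i, x i 0 = 0 \/ x i 0 = 1)
    & pen_min G beta = pen_obj G beta x.
Proof. by eexists; last reflexivity; apply/binvecP; eexists. Qed.

Lemma pen_min_le (R : realType) (n : nat) (G : sgraph n) (beta : R)
    (x : 'cV[R]_n) :
  (forall i, x i 0 = 0 \/ x i 0 = 1) -> pen_min G beta <= pen_obj G beta x.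
Proof.
by move=> /binvecP[b ->]; rewrite /pen_min; case: arg_minP => // c _; apply.
Qed.

(* Main.v *)
Require Import Defs.
From mathcomp Require Import all_boot all_order all_algebra reals.
From mathcomp Require Import lra.

Import Order.TTheory GRing.Theory Num.Theory.
Local Open Scope ring_scope.

(* On the indicator vector of a vertex set S the objective is
   - |S| + beta d(S), where d(S) is twice the number of edges induced by S. As
   long as S is not stable, removing an endpoint of an induced edge lowers |S|
   by 1 and d(S) by at least 2, so 2 |S| - d(S) does not decrease, and S can be
   thinned out to a stable set. *)

Definition degree_sum {n : nat} (G : sgraph n) (S : {set 'I_n}) : nat :=
  (\sum_(u in S) \sum_(v in S) G u v)%N.

Lemma stable_set0 (n : nat) (G : sgraph n) : stable_set G set0.
Proof. by apply/forall_inP => u; rewrite inE. Qed.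

Lemma stable_set_leq (n : nat) (G : sgraph n) (S : {set 'I_n}) :
  stable_set G S -> (#|S| <= stability_number G)%N.
Proof. by move=> stS; exact: (bigop.bigmax_sup S). Qed.

Lemma stability_number_attained (n : nat) (G : sgraph n) :
  exists2 S, stable_set G S & stability_number G = #|S|.
Proof.
have stG_gt0 : (0 < #|[pred S | stable_set G S]|)%N.
  by apply/card_gt0P; exists set0; apply: stable_set0.
by have [S] := eq_bigmax_cond (fun S : {set 'I_n} => #|S|) stG_gt0; exists S.
Qed.

Lemma degree_sum_stable (n : nat) (G : sgraph n) (S : {set 'I_n}) :
  stable_set G S -> degree_sum G S = 0%N.
Proof.
move=> /forall_inP stS; apply: big1 => u uS; apply: big1 => v vS.
have [->|neq_uv] := eqVneq u v; first by rewrite adj_irr.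
by have /forall_inP/(_ v vS)/implyP/(_ neq_uv)/negbTE-> := stS u uS.
Qed.

(** Row [u] and column [u] of the adjacency matrix restricted to [S] have equal sums by symmetry,
    and their common entry on the diagonal is 0. *)
Lemma degree_sumD1 (n : nat) (G : sgraph n) (S : {set 'I_n}) (u : 'I_n) :
  u \in S ->
  degree_sum G S = (degree_sum G (S :\ u) + (\sum_(v in S) G u v).*2)%N.
Proof.
move=> uS; rewrite /degree_sum (big_setD1 u uS) /=.
under [X in (_ + X)%N]eq_bigr => w _ do rewrite (big_setD1 u uS) /=.
rewrite big_split /= (big_setD1 u uS) /= adj_irr add0n -addnn.
under [X in (_ + (X + _))%N]eq_bigr => w _ do rewrite adj_sym.
by rewrite addnA addnC.
Qed.

(** The form avoids both halves and truncated subtraction in [nat]. *)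
Lemma double_card_le_degree_sum (n : nat) (G : sgraph n) (S : {set 'I_n}) :
  (#|S|.*2 <= (stability_number G).*2 + degree_sum G S)%N.
Proof.
have [k] := ubnP #|S|; elim: k S => // k IHk S; rewrite ltnS => leSk.
have [stS|] := boolP (stable_set G S).
  by rewrite (leq_trans _ (leq_addr _ _)) // leq_double stable_set_leq.
case/forall_inPn => u uS /forall_inPn[v vS]; rewrite negb_imply negbK.
case/andP=> _ Guv; have cardS := cardsD1 u S; rewrite uS add1n in cardS.
(* The neighbour [v] makes the degree of [u] in [S] positive, so deleting [u] costs the right side
   at least 2, as much as the left. *)
have degu : (0 < \sum_(w in S) G u w)%N by rewrite (big_setD1 v vS) /= Guv.
rewrite (degree_sumD1 _ _ _ _ uS) cardS doubleS addnA -addn2.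
by rewrite leq_add ?IHk -?cardS // -[2%N]/(1.*2) leq_double.
Qed.

Lemma pen_obj_binvec (R : realType) (n : nat) (G : sgraph n) (beta : R)
    (b : 'cV[bool]_n) (S := [set i | b i 0]) :
  pen_obj G beta (binvec R b) = - #|S|%:R + beta * (degree_sum G S)%:R.
Proof.
(* Matrix products sum over all indices, so membership in [S] becomes a 0/1 weight. *)
have sumS (f : 'I_n -> R) : \sum_(i in S) f i = \sum_i (b i 0)%:R * f i.
  rewrite big_mkcond; apply: eq_bigr => i _; rewrite inE.
  by case: (b i 0); rewrite ?mul1r ?mul0r.
rewrite /pen_obj -mulmxA !mxE -sum1_card natr_sum sumS.
congr (- _ + beta * _).
  by apply: eq_bigr => i _; rewrite !mxE mul1r mulr1.
rewrite natr_sum sumS; apply: eq_bigr => i _; rewrite !mxE natr_sum sumS.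
by congr (_ * _); apply: eq_bigr => j _; rewrite !mxE mulrC.
Qed.

Theorem lemma2 (R : realType) (n : nat) (G : sgraph n) (beta : R) :
  1 / 2 <= beta ->
  (stability_number G)%:R = pen_stability_number G beta.
Proof.
move=> beta_ge; apply/eqP; rewrite eq_le /pen_stability_number; apply/andP.
split.
  (* The indicator vector of a maximum stable set has no penalty and bounds the minimum from
     above. *)
  have [S stS ->] := stability_number_attained n G.
  rewrite lerNr; pose b : 'cV_n := \col_i (i \in S).
  have bS : [set i | b i 0] = S by apply/setP => i; rewrite !inE mxE.
  apply: (le_trans (pen_min_le G beta (x := binvec R b) _)).
    by apply/binvecP; exists b.
  by rewrite pen_obj_binvec bS degree_sum_stable // mulr0 addr0.
(* Conversely, a minimizer is the indicator of some [S], possibly not stable. *)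
have [_ /binvecP[b ->] ->] := pen_min_attained G beta.
rewrite pen_obj_binvec; set S := [set i | b i 0].
have := double_card_le_degree_sum n G S.
rewrite -(ler_nat R) natrD -!muln2 !natrM.
(* Since [beta] is at least 1/2, |S| - beta d(S) <= |S| - d(S)/2, which is at most the stability
   number. *)
have : 0 <= (beta - 1 / 2) * (degree_sum G S)%:R by rewrite mulr_ge0 ?subr_ge0.
by rewrite mulrBl; lra.
Qed.
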